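(* Let $q=2^s$ with $s\geq 2$, let $m\geq 1$ be an integer, and let $O_2^+(\mathbb{F}_q)=\langle\sigma,\tau_a : a\in\mathbb{F}_q^\times\rangle\subset \mathrm{GL}_2(\mathbb{F}_q)$, where $\sigma=\begin{pmatrix}0&1\\1&0\end{pmatrix}$ and $\tau_a=\begin{pmatrix}a&0\\0&a^{-1}\end{pmatrix}$. Let $O_2^+(\mathbb{F}_q)$ act by $\mathbb{F}_q$-algebra automorphisms on the polynomial ring $\mathbb{F}_q[mV]:=\mathbb{F}_q[x_1,\dots,x_m,y_1,\dots,y_m]$ by $\sigma(x_i)=y_i$, $\sigma(y_i)=x_i$, $\tau_a(x_i)=a^{-1}x_i$, $\tau_a(y_i)=a y_i$ for $1\leq i\leq m$. Then the invariant ring $\mathbb{F}_q[mV]^{O_2^+(\mathbb{F}_q)}$ is generated as an $\mathbb{F}_q$-algebra by the union of the sets $$\mathcal{N}=\{N_i=x_iy_i \mid 1\leq i\leq m\},\qquad \mathcal{U}=\{U_{ij}=x_iy_j+x_jy_i\mid 1\leq i<j\leq m\},$$ $$\mathcal{B}=\{B_\alpha=x_1^{\alpha_1}\cdots x_m^{\alpha_m}+y_1^{\alpha_1}\cdots y_m^{\alpha_m}\mid \alpha\in\mathbb{N}^m,\ |\alpha|=q-1\},$$ $$\mathcal{D}=\{d_{I,J}=x_Iy_J+y_Ix_J\mid I,J\subseteq\{1,\dots,m\}\text{ nonempty},\ I<J,\ |J|-|I|=0\text{ or }q-1\}.$$ Moreover, $\mathcal{N}\cup\mathcal{B}\cup\mathcal{D}$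 is a minimal generating set of the $\mathbb{F}_q$-algebra $\mathbb{F}_q[mV]^{O_2^+(\mathbb{F}_q)}$.
   Context: $\mathbb{N}=\{0,1,2,\dots\}$. For $\alpha=(\alpha_1,\dots,\alpha_m)\in\mathbb{N}^m$, $|\alpha|=\sum_i\alpha_i$. For a nonempty subset $I\subseteq\{1,\dots,m\}$, $x_I=\prod_{i\in I}x_i$, $y_I=\prod_{i\in I}y_i$, and $|I|$ is the cardinality of $I$. For nonempty subsets $I,J$, write $I<J$ if $i<j$ for all $i\in I$ and all $j\in J$. A generating set is minimal if no proper subset of it generates the algebra. *)

(* Defs.v *)
From HB Require Import structures.
From mathcomp Require Import all_boot all_order all_algebra all_fingroup.
From mathcomp Require Export mpoly.

Set Implicit Arguments.
Unset Strict Implicit.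
Unset Printing Implicit Defensive.

Import GRing.Theory.
Local Open Scope ring_scope.

(* Sets of elements of an algebra are predicates with values in Prop. *)
Section Generation.
Variables (K : fieldType) (A : algType K).
Implicit Types S T R : A -> Prop.

Definition union S T : A -> Prop := fun p => S p \/ T p.

Inductive subalg_gen S : A -> Prop :=
| SubalgIn p : S p -> subalg_gen S p
| SubalgOne : subalg_gen S 1
| SubalgScale (c : K) p : subalg_gen S p -> subalg_gen S (c *: p)
| SubalgAdd p r : subalg_gen S p -> subalg_gen S r -> subalg_gen S (p + r)
| SubalgMul p r : subalg_gen S p -> subalg_gen S r -> subalg_gen S (p * r).

Definition generates S R : Prop := forall p, subalg_gen S p <-> R p.

Definition proper_subset T S : Prop :=
  (forall p, T p -> S p) /\ exists2 p, S p & ~ T p.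

Definition minimal_generating_set S R : Prop :=
  generates S R /\ forall T, proper_subset T S -> ~ generates T R.

End Generation.

Section Group.
Variable F : finFieldType.

Definition mx2 (a b c d : F) : 'M[F]_2 :=
  \matrix_(i < 2, j < 2) nth 0 (nth [::] [:: [:: a; b]; [:: c; d]] i) j.

Lemma det_mx2 a b c d : \det (mx2 a b c d) = a * d - b * c.
Proof.
rewrite (expand_det_row _ ord0) !big_ord_recl big_ord0 addr0.
rewrite /cofactor !det_mx11 !mxE /= /bump /=.
by rewrite expr0 expr1 mul1r mulN1r mulrN.
Qed.

Lemma mulmx2 a b c d a' b' c' d' :
  mx2 a b c d *m mx2 a' b' c' d' =
  mx2 (a * a' + b * c') (a * b' + b * d') (c * a' + d * c') (c * b' + d * d').
Proof.
apply/matrixP => -[[|[|//]] ?] [[|[|//]] ?];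
by rewrite !mxE !big_ord_recl big_ord0 !mxE /= addr0.
Qed.

Lemma mx2_1 : mx2 1 0 0 1 = 1%:M.
Proof. by apply/matrixP => -[[|[|//]] ?] [[|[|//]] ?]; rewrite !mxE. Qed.

Fact sigma_unit : mx2 0 1 1 0 \is a GRing.unit.
Proof.
by change (mx2 0 1 1 0 \in unitmx); rewrite unitmxE det_mx2 mul0r mulr1 sub0r unitrN1.
Qed.

Fact tau_unit (a : {unit F}) : mx2 (val a) 0 0 (val a)^-1 \is a GRing.unit.
Proof.
change (mx2 (val a) 0 0 (val a)^-1 \in unitmx); rewrite unitmxE det_mx2 mulr0 subr0.
by rewrite divrr ?unitr1 ?(valP a).
Qed.

Definition sigma : {'GL_2[F]} := FinRing.Unit sigma_unit.
Definition tau (a : {unit F}) : {'GL_2[F]} := FinRing.Unit (tau_unit a).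

Definition O2plus : {set {'GL_2[F]}} :=
  <<sigma |: [set tau a | a : {unit F}]>>%g.

End Group.

Section VectorInvariants.
Variables (F : finFieldType) (m : nat).

(* The 2m indeterminates are x_1, ..., x_m followed by y_1, ..., y_m. *)
Definition xv (i : 'I_m) : {mpoly F[m + m]} := 'X_(lshift m i).
Definition yv (i : 'I_m) : {mpoly F[m + m]} := 'X_(rshift m i).

(* x_i, y_i are the coordinate functions on the i-th copy of V = F^2, on which
   g acts by precomposition with g^-1: it sends the column (x_i, y_i) to
   g^-1 (x_i, y_i). *)
Definition mvact_var (g : {'GL_2[F]}) (k : 'I_(m + m)) : {mpoly F[m + m]} :=
  let h : 'M[F]_2 := GLval g^-1%g in
  match split k with
  | inl i => h ord0 ord0 *: xv i + h ord0 ord_max *: yv i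
  | inr i => h ord_max ord0 *: xv i + h ord_max ord_max *: yv i
  end.

Definition mvact (g : {'GL_2[F]}) (p : {mpoly F[m + m]}) : {mpoly F[m + m]} :=
  p \mPo [tuple mvact_var g k | k < m + m].

Lemma mvact_x g i : mvact g (xv i) =
  (GLval g^-1%g : 'M_2) ord0 ord0 *: xv i + (GLval g^-1%g : 'M_2) ord0 ord_max *: yv i.
Proof.
rewrite /mvact /xv comp_mpolyXU -tnth_nth tnth_mktuple /mvact_var.
by rewrite -[lshift m i]/(unsplit (inl i)) unsplitK.
Qed.

Lemma mvact_y g i : mvact g (yv i) =
  (GLval g^-1%g : 'M_2) ord_max ord0 *: xv i + (GLval g^-1%g : 'M_2) ord_max ord_max *: yv i.
Proof.
rewrite /mvact /yv comp_mpolyXU -tnth_nth tnth_mktuple /mvact_var.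
by rewrite -[rshift m i]/(unsplit (inr i)) unsplitK.
Qed.

Lemma sigmaV : (sigma F)^-1%g = sigma F.
Proof.
apply: (mulgI (sigma F)); rewrite mulgV; apply: val_inj.
change (1%:M = mx2 0 1 1 0 *m mx2 0 1 1 0 :> 'M[F]_2).
by rewrite mulmx2 !(mul0r, mul1r, add0r, addr0) mx2_1.
Qed.

Lemma tauV (a : {unit F}) : (tau a)^-1%g = tau a^-1%g.
Proof.
apply: (mulgI (tau a)); rewrite mulgV; apply: val_inj.
have Ua := valP a.
change (1%:M = mx2 (val a) 0 0 (val a)^-1
                 *m mx2 (val a)^-1 0 0 (val a)^-1^-1).
rewrite mulmx2 !(mul0r, mulr0, add0r, addr0) invrK.
by rewrite divrr // mulVr // mx2_1.
Qed.

Lemma mvact_sigma i : mvact (sigma F) (xv i) = yv i /\ mvact (sigma F) (yv i) = xv i.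
Proof.
by rewrite mvact_x mvact_y sigmaV !mxE /= !scale0r !scale1r add0r addr0.
Qed.

Lemma mvact_tau (a : {unit F}) i :
  mvact (tau a) (xv i) = (val a)^-1 *: xv i /\ mvact (tau a) (yv i) = val a *: yv i.
Proof.
by rewrite mvact_x mvact_y tauV !mxE /= !scale0r add0r addr0 invrK.
Qed.

Lemma mvactM g h p : mvact (g * h)%g p = mvact g (mvact h p).
Proof.
rewrite {1 3}/mvact !comp_mpolyEX /mvact raddf_sum /=.
apply: eq_bigr => n _; rewrite linearZ /=; congr (_ *: _).
rewrite !comp_mpolyX rmorph_prod /=; apply: eq_bigr => k _.
rewrite rmorphXn /= !tnth_mktuple; congr (_ ^+ _).
rewrite /mvact_var invgM GL_MxE; case: (split k) => i;
rewrite linearD !linearZ /=; move: (mvact_x g i) (mvact_y g i); rewrite /mvact => -> ->;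
rewrite !mxE !big_ord_recl !big_ord0 !addr0;
have -> : lift ord0 ord0 = ord_max :> 'I_2 by exact: val_inj.
- by rewrite !scalerDl !scalerDr !scalerA addrACA.
- by rewrite !scalerDl !scalerDr !scalerA addrACA.
Qed.

Definition O2_invariant (p : {mpoly F[m + m]}) : Prop :=
  forall g, g \in O2plus F -> mvact g p = p.

Definition xset (I : {set 'I_m}) : {mpoly F[m + m]} := \prod_(i in I) xv i.
Definition yset (I : {set 'I_m}) : {mpoly F[m + m]} := \prod_(i in I) yv i.

Definition set_lt (I J : {set 'I_m}) : Prop :=
  forall i j, i \in I -> j \in J -> (i < j)%N.

Definition calN (p : {mpoly F[m + m]}) : Prop := exists i, p = xv i * yv i.

Definition calU (p : {mpoly F[m + m]}) : Prop :=
  exists i j : 'I_m, (i < j)%N /\ p = xv i * yv j + xv j * yv i.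

Definition calB (p : {mpoly F[m + m]}) : Prop :=
  exists alpha : 'X_{1..m}, mdeg alpha = (#|F| - 1)%N /\
    p = \prod_(i < m) xv i ^+ alpha i + \prod_(i < m) yv i ^+ alpha i.

(* |J| - |I| = 0 or q - 1, written without truncated subtraction. *)
Definition calD (p : {mpoly F[m + m]}) : Prop :=
  exists I J : {set 'I_m},
    [/\ I != set0, J != set0, set_lt I J,
        (#|J| = #|I| \/ #|J| = #|I| + (#|F| - 1))%N
      & p = xset I * yset J + yset I * xset J].

End VectorInvariants.

Arguments O2_invariant F m p : clear implicits.
Arguments calN F m p : clear implicits.
Arguments calU F m p : clear implicits.
Arguments calB F m p : clear implicits.
Arguments calD F m p : clear implicits.

(* Main.v *)
Require Import Defs.
From mathcomp Require Import all_boot all_order all_algebra all_fingroup.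
From mathcomp Require Import cyclic finfield zify ring.

Set Implicit Arguments.
Unset Strict Implicit.
Unset Printing Implicit Defensive.

Import GRing.Theory.
Local Open Scope ring_scope.

(** The torus elements tau_u are diagonal on monomials: x^a y^b is fixed by all of
them exactly when |a| and |b| agree modulo q - 1 (it is then called balanced
below), because the units of F form a cyclic group of order q - 1. As sigma
exchanges x^a y^b and x^b y^a, the invariants are spanned by the monomials x^a y^a,
which are products of the N_i, and by the orbit sums
    tr a b = x^a y^b + x^b y^a
of balanced monomials (invariant_in_subalg).

Generation (gen_tr) is an induction on the degree, based on the identity
    tr (a + c) (b + d) = tr a b * tr c d - tr (a + d) (b + c).
Modulo invariants of smaller degree, any balanced proper factor x^c y^d of a
monomial can thus be replaced by x^d y^c. Swapping a factor of q - 1 of the x's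
reduces the imbalance | |a| - |b| | to 0 or q - 1. Swapping a pair x_i y_j into
y_i x_j then produces a factor N_i if x_i occurs twice, and otherwise sorts the
indices; what remains is a sorted squarefree monomial, which gives an element of
calD, or a monomial in the x's alone, which gives an element of calB. Every U_ij
is itself an orbit sum.

For minimality, each generator p gets a linear functional that does not vanish
on p but vanishes on 1, on all other generators and on all products of two
invariants without constant term (detects). Such a functional vanishes on every
subalgebra generated by other generators (detected_not_generated). For N_i and
B_alpha, the coefficient of a monomial will do, because that monomial has no proper
balanced factor. For d_(I,J), which is decomposable up to another orbit sum with the
same support, single coefficients do not suffice. There, with k0 in I, one sends
y_k0 to 0 and every other x_i and y_i to a common variable, and takes the
coefficient of the squarefree monomial with support I and J together. In a product
of two invariants without constant term, one of the factors contributes a monomial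
that avoids k0, and the corresponding coefficient is 0: it is 2 times something,
and F has characteristic 2. Finally, the support determines I and J, because q - 1
is odd. *)

(** * Generated subalgebras *)

Section Subalgebra.
Variables (K : fieldType) (A : algType K).
Implicit Types (S T : A -> Prop) (p r : A).

Lemma subalg_gen_sub S T p :
  (forall r, S r -> subalg_gen T r) -> subalg_gen S p -> subalg_gen T p.
Proof.
move=> ST; elim=> {p} [p /ST //||c p _|p r _ Tp _|p r _ Tp _].
- exact: SubalgOne.
- exact: SubalgScale.
- exact: SubalgAdd.
- exact: SubalgMul.
Qed.

Lemma subalg_gen0 S : subalg_gen S 0.
Proof. by rewrite -(scale0r 1); apply/SubalgScale/SubalgOne. Qed.

Lemma subalg_genB S p r : subalg_gen S p -> subalg_gen S r -> subalg_gen S (p - r).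
Proof. by move=> Sp Sr; rewrite -scaleN1r; apply/SubalgAdd/SubalgScale. Qed.

Lemma subalg_gen_exp S p n : subalg_gen S p -> subalg_gen S (p ^+ n).
Proof.
move=> Sp; elim: n => [|n IHn]; first exact: SubalgOne.
by rewrite exprS; apply: SubalgMul.
Qed.

Lemma subalg_gen_prod S (I : finType) (f : I -> A) :
  (forall i, subalg_gen S (f i)) -> subalg_gen S (\prod_i f i).
Proof. by move=> Sf; apply: big_ind => //; [apply: SubalgOne | apply: SubalgMul]. Qed.

End Subalgebra.

(** * Bihomogeneous monomials and orbit sums *)

Section Monomials.
Variables (F : finFieldType) (m : nat).
Implicit Types (a b c d : 'X_{1..m}) (n : 'X_{1..m + m}) (p : {mpoly F[m + m]}).

Definition join a b : 'X_{1..m + m} :=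
  [multinom match split k with inl i => a i | inr i => b i end | k < m + m].
Definition xpart n : 'X_{1..m} := [multinom n (lshift m i) | i < m].
Definition ypart n : 'X_{1..m} := [multinom n (rshift m i) | i < m].

Lemma join_l a b i : join a b (lshift m i) = a i.
Proof. by rewrite mnmE -[lshift m i]/(unsplit (inl i)) unsplitK. Qed.

Lemma join_r a b i : join a b (rshift m i) = b i.
Proof. by rewrite mnmE -[rshift m i]/(unsplit (inr i)) unsplitK. Qed.

Lemma xpart_join a b : xpart (join a b) = a.
Proof. by apply/mnmP => i; rewrite mnmE join_l. Qed.

Lemma ypart_join a b : ypart (join a b) = b.
Proof. by apply/mnmP => i; rewrite mnmE join_r. Qed.

Lemma join_parts n : join (xpart n) (ypart n) = n.
Proof.
apply/mnmP => k; rewrite mnmE -[in RHS](splitK k).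
by case: (split k) => i; rewrite mnmE.
Qed.

Lemma eq_join a b c d : (join a b == join c d) = (a == c) && (b == d).
Proof.
apply/eqP/andP => [E|[/eqP -> /eqP ->] //].
by move: (congr1 xpart E) (congr1 ypart E); rewrite !xpart_join !ypart_join => -> ->.
Qed.

Lemma joinD a b c d : join (a + c)%MM (b + d)%MM = (join a b + join c d)%MM.
Proof.
by apply/mnmP => k; rewrite mnmDE !mnmE; case: (split k) => i; rewrite mnmDE.
Qed.

Lemma xpartD n n' : xpart (n + n')%MM = (xpart n + xpart n')%MM.
Proof. by apply/mnmP => i; rewrite !(mnmE, mnmDE). Qed.

Lemma ypartD n n' : ypart (n + n')%MM = (ypart n + ypart n')%MM.
Proof. by apply/mnmP => i; rewrite !(mnmE, mnmDE). Qed.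

Definition swap n := join (ypart n) (xpart n).

Lemma swapK : involutive swap.
Proof. by move=> n; rewrite /swap xpart_join ypart_join join_parts. Qed.

Lemma join0 : join 0%MM 0%MM = 0%MM.
Proof. by apply/mnmP => k; rewrite mnmE; case: split => i; rewrite !mnm0E. Qed.

Definition mon a b : {mpoly F[m + m]} := 'X_[join a b].

(** The orbit sum of the monomial x^a y^b under sigma, up to the factor 2 when
a = b: in that case x^a y^a is itself invariant. *)
Definition tr a b := mon a b + mon b a.

Lemma trC a b : tr a b = tr b a.
Proof. exact: addrC. Qed.

Lemma monE a b :
  mon a b = (\prod_(i < m) xv F i ^+ a i) * (\prod_(i < m) yv F i ^+ b i).
Proof.
rewrite /mon mpolyXE_id big_split_ord /=.
by congr (_ * _); apply: eq_bigr => i _; rewrite (join_l, join_r).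
Qed.

Lemma monM a b c d : mon a b * mon c d = mon (a + c)%MM (b + d)%MM.
Proof. by rewrite /mon joinD mpolyXD. Qed.

Lemma mcoeff_mon a b c d :
  (mon a b)@_(join c d) = ((a == c) && (b == d))%:R.
Proof. by rewrite mcoeffX eq_join. Qed.

(** The identity behind the whole generation argument: a product of two orbit sums
lets the second factor be swapped, modulo decomposable elements. *)
Lemma trM a b c d :
  tr a b * tr c d = tr (a + c)%MM (b + d)%MM + tr (a + d)%MM (b + c)%MM.
Proof. by rewrite /tr mulrDl !mulrDr !monM; ring. Qed.

Lemma xset_prod (I : {set 'I_m}) :
  xset F I = \prod_(i < m) xv F i ^+ (i \in I).
Proof. by rewrite /xset big_mkcond; apply: eq_bigr => i _; case: (i \in I). Qed.

Lemma yset_prod (I : {set 'I_m}) :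
  yset F I = \prod_(i < m) yv F i ^+ (i \in I).
Proof. by rewrite /yset big_mkcond; apply: eq_bigr => i _; case: (i \in I). Qed.

Definition ind (I : {set 'I_m}) : 'X_{1..m} := [multinom (i \in I : nat) | i < m].

Lemma indE I i : ind I i = (i \in I).
Proof. exact: mnmE. Qed.

Lemma mdeg_ind I : mdeg (ind I) = #|I|.
Proof.
rewrite mdegE -sum1_card [RHS]big_mkcond; apply: eq_bigr => i _; rewrite indE.
by case: (i \in I).
Qed.

Lemma ind_inj : injective ind.
Proof.
move=> I J E; apply/setP => i; apply: (can_inj oddb).
by rewrite -!indE E.
Qed.

Lemma mon_xy i j : xv F i * yv F j = mon U_(i) U_(j).
Proof.
have U1 (f : 'I_m -> {mpoly F[m + m]}) k : f k = \prod_(l < m) f l ^+ U_(k)%MM l.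
  rewrite (bigD1 k) //= big1 ?mulr1 ?mnm1E ?eqxx // => l.
  by rewrite mnm1E eq_sym => /negPf ->.
by rewrite monE -!U1.
Qed.

Lemma tr_B a :
  \prod_(i < m) xv F i ^+ a i + \prod_(i < m) yv F i ^+ a i = tr a 0%MM.
Proof.
rewrite /tr !monE; congr (_ + _).
  by rewrite [X in _ * X]big1 ?mulr1 // => i _; rewrite mnm0E.
by rewrite [X in X * _]big1 ?mul1r // => i _; rewrite mnm0E.
Qed.

Lemma tr_D (I J : {set 'I_m}) :
  xset F I * yset F J + yset F I * xset F J = tr (ind I) (ind J).
Proof.
have xE K : xset F K = \prod_(i < m) xv F i ^+ ind K i.
  by rewrite xset_prod; apply: eq_bigr => i _; rewrite indE.
have yE K : yset F K = \prod_(i < m) yv F i ^+ ind K i.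
  by rewrite yset_prod; apply: eq_bigr => i _; rewrite indE.
by rewrite /tr !monE !xE !yE [X in _ + X = _]mulrC.
Qed.

End Monomials.

(** * The invariants as combinations of orbit sums *)

Section Invariants.
Variables (F : finFieldType) (m : nat).
Implicit Types (a b c d : 'X_{1..m}) (n : 'X_{1..m + m}) (p : {mpoly F[m + m]}).

Local Notation q1 := (#|F| - 1)%N.

Lemma mvact_mon (g : {'GL_2[F]}) a b :
  mvact g (mon F a b) = (\prod_(i < m) mvact g (xv F i) ^+ a i) *
                        (\prod_(i < m) mvact g (yv F i) ^+ b i).
Proof.
rewrite monE /mvact rmorphM !rmorph_prod /=.
by congr (_ * _); apply: eq_bigr => i _; rewrite rmorphXn.
Qed.

Lemma mvact_sigma_mon a b : mvact (sigma F) (mon F a b) = mon F b a.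
Proof.
rewrite mvact_mon monE mulrC; congr (_ * _); apply: eq_bigr => i _;
by rewrite ?(mvact_sigma F i).1 ?(mvact_sigma F i).2.
Qed.

Lemma mvact_tau_mon (u : {unit F}) a b :
  mvact (tau u) (mon F a b) = ((val u)^-1 ^+ mdeg a * val u ^+ mdeg b) *: mon F a b.
Proof.
rewrite mvact_mon monE.
under eq_bigr => i _ do rewrite (mvact_tau u i).1 exprZn.
under [X in _ * X]eq_bigr => i _ do rewrite (mvact_tau u i).2 exprZn.
by rewrite !scaler_prod !prodrXr -!mdegE -scalerAl -scalerAr scalerA.
Qed.

Lemma mvact1 p : mvact 1%g p = p.
Proof.
rewrite -[RHS]comp_mpoly_id /mvact; congr comp_mpoly.
apply: eq_from_tnth => k; rewrite !tnth_mktuple /mvact_var invg1.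
rewrite -[in RHS](splitK k); case: (split k) => i;
by rewrite !mxE /= scale1r scale0r ?addr0 ?add0r.
Qed.

(** The elements fixing a given p form a subgroup, so invariance need only be
tested on the generators. *)
Lemma O2_invariantP p :
  O2_invariant F m p <->
  mvact (sigma F) p = p /\ forall u : {unit F}, mvact (tau u) p = p.
Proof.
split=> [inv | [fix_s fix_t] g].
  split=> [|u]; apply: inv; apply: mem_gen; first exact: setU11.
  by rewrite setU1r // imset_f.
pose H := [set g | mvact g p == p].
have gH : group_set H.
  apply/group_setP; split=> [|h k]; first by rewrite inE mvact1.
  rewrite !inE => /eqP hp /eqP kp.
  by rewrite mvactM kp hp.
have /subsetP sOH : O2plus F \subset Group gH.
  rewrite gen_subG; apply/subsetP => h; rewrite !inE => /orP[/eqP -> | /imsetP[u _ ->]];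
  exact/eqP.
by move/sOH; rewrite inE => /eqP.
Qed.

Lemma invariant1 : O2_invariant F m 1.
Proof. by move=> g _; rewrite /mvact rmorph1. Qed.

Lemma invariantD p r : O2_invariant F m p -> O2_invariant F m r -> O2_invariant F m (p + r).
Proof. by move=> ip ir g gO; rewrite /mvact comp_mpolyD [p \mPo _]ip // [r \mPo _]ir. Qed.

Lemma invariantZ (c : F) p : O2_invariant F m p -> O2_invariant F m (c *: p).
Proof. by move=> ip g gO; rewrite /mvact comp_mpolyZ [p \mPo _]ip. Qed.

Lemma invariantM p r : O2_invariant F m p -> O2_invariant F m r -> O2_invariant F m (p * r).
Proof. by move=> ip ir g gO; rewrite /mvact rmorphM /= [p \mPo _]ip // [r \mPo _]ir. Qed.

Lemma invariant_subalg (S : {mpoly F[m + m]} -> Prop) p :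
  (forall r, S r -> O2_invariant F m r) -> subalg_gen S p -> O2_invariant F m p.
Proof.
move=> iS; elim=> {p} [p /iS //||c p _|p r _ ip _|p r _ ip _].
- exact: invariant1.
- exact: invariantZ.
- exact: invariantD.
- exact: invariantM.
Qed.

(** The monomial x^a y^b is fixed by the torus exactly when it is balanced. *)
Definition balanced a b := mdeg a == mdeg b %[mod q1].

Lemma unit_exp_balanced (u : F) a b :
  u != 0 -> balanced a b -> u ^+ mdeg a = u ^+ mdeg b.
Proof.
move=> u0 /eqP ab.
have u1 : u ^+ q1 = 1.
  apply: (mulIf u0); rewrite -exprSr subn1 prednK ?expf_card ?mul1r //.
  exact: ltnW (finNzRing_gt1 F).
rewrite (divn_eq (mdeg a) q1) (divn_eq (mdeg b) q1) ab.
by rewrite !exprD ![(_ * q1)%N]mulnC !exprM u1 !expr1n.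
Qed.

Lemma invariant_tr a b : balanced a b -> O2_invariant F m (tr F a b).
Proof.
move=> ab; apply/O2_invariantP; split=> [|u].
  by rewrite {1}/mvact comp_mpolyD [mon F a b \mPo _]mvact_sigma_mon
     [mon F b a \mPo _]mvact_sigma_mon addrC.
have u0 : val u != 0 by rewrite -unitfE (valP u).
rewrite /mvact comp_mpolyD [mon F a b \mPo _]mvact_tau_mon
     [mon F b a \mPo _]mvact_tau_mon !exprVn (unit_exp_balanced u0 ab).
by rewrite mulVf ?expf_neq0 // !scale1r.
Qed.

Lemma invariant_monaa a : O2_invariant F m (mon F a a).
Proof.
apply/O2_invariantP; split=> [|u]; first exact: mvact_sigma_mon.
by rewrite mvact_tau_mon -exprMn mulVf ?expr1n ?scale1r // -unitfE (valP u).
Qed.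

Lemma mvact_sum (g : {'GL_2[F]}) p :
  mvact g p = \sum_(k <- msupp p) p@_k *: mvact g 'X_[k].
Proof.
rewrite {1}[p]mpolyE /mvact (raddf_sum (comp_mpoly _)) /=.
by apply: eq_bigr => k _; rewrite comp_mpolyZ.
Qed.

Lemma mcoeff_sigma p n : (mvact (sigma F) p)@_(swap n) = p@_n.
Proof.
rewrite mvact_sum [in RHS](mpolyE p) !(raddf_sum (mcoeff _)) /=; apply: eq_bigr => k _.
rewrite !mcoeffZ; congr (_ * _); rewrite -{1}[k]join_parts mvact_sigma_mon /mon.
by rewrite -/(swap k) !mcoeffX (inj_eq (inv_inj (@swapK m))).
Qed.

Lemma mcoeff_tau p (u : {unit F}) n :
  (mvact (tau u) p)@_n = (val u)^-1 ^+ mdeg (xpart n) * val u ^+ mdeg (ypart n) * p@_n.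
Proof.
rewrite mvact_sum [in RHS](mpolyE p) !(raddf_sum (mcoeff _)) /= mulr_sumr.
apply: eq_bigr => k _.
rewrite !mcoeffZ -{2}[k]join_parts mvact_tau_mon.
rewrite mcoeffZ /mon join_parts mcoeffX; have [->|] := eqVneq k n; first by rewrite mulrCA.
by rewrite !mulr0.
Qed.

(** A generator u of the cyclic group of units of F scales x^a y^b by
u^(|b| - |a|), so tau u alone already forces q - 1 to divide |b| - |a|. *)
Lemma invariant_balanced p n :
  O2_invariant F m p -> p@_n != 0 -> balanced (xpart n) (ypart n).
Proof.
move=> /O2_invariantP[_ inv] pn.
have /cyclicP[g Dg] : cyclic [set: {unit F}] by apply: field_unit_group_cyclic.
have og : #[g]%g = q1 by rewrite /order -Dg card_finField_unit subn1.
rewrite /balanced -og -eq_expg_mod_order; apply/eqP/val_inj.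
rewrite !FinRing.val_unitX.
have := mcoeff_tau p g n; rewrite inv => /eqP.
rewrite -{1}[p@_n]mul1r (inj_eq (mulIf pn)) => /eqP E.
have g0 : val g != 0 by rewrite -unitfE (valP g).
apply: (mulfI (expf_neq0 (mdeg (xpart n)) (invr_neq0 g0))).
by rewrite -E -exprMn mulVf // expr1n.
Qed.

Lemma invariant_swap p n : O2_invariant F m p -> p@_(swap n) = p@_n.
Proof. by move=> /O2_invariantP[inv _]; rewrite -{1}inv mcoeff_sigma. Qed.

(** The coefficients of an invariant are constant on the orbits of sigma and
supported on balanced monomials; the induction strips one orbit at a time from
the support. *)
Lemma invariant_in_subalg (S : {mpoly F[m + m]} -> Prop) p :
  (forall a, subalg_gen S (mon F a a)) ->
  (forall a b, balanced a b -> subalg_gen S (tr F a b)) ->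
  O2_invariant F m p -> subalg_gen S p.
Proof.
move=> Sa St; have [k] := ubnP (size (msupp p)).
elim: k p => // k IHk p; rewrite ltnS => szp ip.
case Dp: (msupp p) => [|n s]; first by rewrite (msuppnil0 Dp); apply: subalg_gen0.
have pn : p@_n != 0 by rewrite -mcoeff_msupp Dp inE eqxx.
set a := xpart n; set b := ypart n.
pose e := p@_n *: (if a == b then mon F a a else tr F a b).
have ab : balanced a b by apply: invariant_balanced pn.
have Se : subalg_gen S e by apply: SubalgScale; case: eqP => _; auto.
have ie : O2_invariant F m e.
  apply: invariantZ; case: eqP => _; [exact: invariant_monaa | exact: invariant_tr].
rewrite -(subrK e p); apply: SubalgAdd => //.
apply: IHk; last first.
  by rewrite -scaleN1r; apply: invariantD => //; apply: invariantZ.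
apply: leq_trans szp; rewrite Dp /= ltnS.
apply: uniq_leq_size; first exact: msupp_uniq.
move=> l; rewrite mcoeff_msupp mcoeffB => Hl.
have en : e@_n = p@_n.
  rewrite /e mcoeffZ -(join_parts n) -/a -/b; case: eqP => [->|/eqP nab].
    by rewrite mcoeff_mon !eqxx mulr1.
  by rewrite mcoeffD !mcoeff_mon !eqxx [b == a]eq_sym (negPf nab) addr0 mulr1.
have ln : l != n by apply: contraNneq Hl => ->; rewrite en subrr.
suff pl : p@_l != 0 by move: pl; rewrite -mcoeff_msupp Dp inE (negPf ln).
apply: contraNneq Hl => pl0; rewrite pl0 sub0r oppr_eq0.
have lsn : l != swap n.
  by apply: contraNneq pn => lsn; rewrite -(invariant_swap n ip) -lsn pl0.
rewrite /e mcoeffZ; move: ln lsn; rewrite -(join_parts l) -{1}(join_parts n) /swap -/a -/b.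
rewrite !eq_join => /negPf nab /negPf nba.
have h1 : (mon F a b)@_(join (xpart l) (ypart l)) = 0.
  by rewrite mcoeff_mon [a == _]eq_sym [b == _]eq_sym nab.
have h2 : (mon F b a)@_(join (xpart l) (ypart l)) = 0.
  by rewrite mcoeff_mon [a == _]eq_sym [b == _]eq_sym nba.
case: (a =P b) h1 => [->|_] h1; first by rewrite h1 mulr0.
by rewrite mcoeffD h1 h2 addr0 mulr0.
Qed.

End Invariants.

(** * Generation *)

Section Generation.
Variables (F : finFieldType) (m : nat).
Implicit Types (a b c d : 'X_{1..m}) (p : {mpoly F[m + m]}).

Local Notation q1 := (#|F| - 1)%N.
Local Notation NBD := (union (calN F m) (union (calB F m) (calD F m))).

Lemma card_pred_gt0 : (0 < q1)%N.
Proof. by rewrite subn_gt0; apply: finNzRing_gt1. Qed.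

Lemma balancedC a b : balanced F a b = balanced F b a.
Proof. exact: eq_sym. Qed.

Lemma balancedDl a b c d :
  balanced F c d -> balanced F (c + a)%MM (d + b)%MM = balanced F a b.
Proof.
rewrite /balanced !mdegD => /eqP cd.
by rewrite -modnDml cd modnDml eqn_modDl.
Qed.

Lemma balancedUU i j : balanced F (U_(i) : 'X_{1..m})%MM U_(j)%MM.
Proof. by rewrite /balanced !mdeg1. Qed.

Lemma NBD_N i : NBD (mon F U_(i) U_(i))%MM.
Proof. by left; exists i; rewrite mon_xy. Qed.

Lemma NBD_B a : mdeg a = q1 -> NBD (tr F a 0%MM).
Proof. by move=> da; right; left; exists a; rewrite tr_B. Qed.

Lemma NBD_D (I J : {set 'I_m}) :
    I != set0 -> J != set0 -> set_lt I J -> #|J| = #|I| \/ #|J| = (#|I| + q1)%N ->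
  NBD (tr F (ind I) (ind J)).
Proof. by move=> I0 J0 IJ cIJ; right; right; exists I, J; rewrite tr_D. Qed.

Lemma gen_monaa a : subalg_gen NBD (mon F a a).
Proof.
rewrite monE -big_split /=; apply: subalg_gen_prod => i.
by rewrite -exprMn; apply/subalg_gen_exp/SubalgIn; left; exists i.
Qed.

Lemma mnm_pos a : (0 < mdeg a)%N -> exists i, (0 < a i)%N.
Proof.
move=> a0; apply/existsP; apply: contraTT a0 => /existsPn a0.
rewrite mdegE big1 // => i _; by have := a0 i; case: (a i).
Qed.

Lemma mnm_subU a i : (0 < a i)%N -> exists a', a = (U_(i) + a')%MM.
Proof.
move=> ai; exists (a - U_(i))%MM; rewrite addmC submK //.
by rewrite lep1mP -lt0n.
Qed.

Lemma mnm_split a k : (k <= mdeg a)%N -> exists c c', a = (c + c')%MM /\ mdeg c = k.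
Proof.
elim: k => [|k IHk] ka; first by exists 0%MM, a; rewrite add0m mdeg0.
have [c [c' [Da dc]]] := IHk (ltnW ka).
have /mnm_pos[i /mnm_subU[e De]] : (0 < mdeg c')%N by move: ka; rewrite Da mdegD dc; lia.
exists (U_(i) + c)%MM, e; split; last by rewrite mdegD mdeg1 dc.
by rewrite Da De addmA [(c + _)%MM]addmC.
Qed.

Definition generated_below k :=
  forall a b, (mdeg a + mdeg b < k)%N -> balanced F a b -> subalg_gen NBD (tr F a b).

(** By the product formula for orbit sums, x^c y^d may be replaced by x^d y^c inside
a monomial as soon as both factors are balanced and nonconstant. *)
Lemma gen_flip k a b c d :
    generated_below k -> (mdeg a + mdeg b + (mdeg c + mdeg d) <= k)%N ->
    balanced F a b -> balanced F c d ->
    (0 < mdeg a + mdeg b)%N -> (0 < mdeg c + mdeg d)%N ->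
    subalg_gen NBD (tr F (a + d)%MM (b + c)%MM) ->
  subalg_gen NBD (tr F (a + c)%MM (b + d)%MM).
Proof.
move=> below dk ab cd ab0 cd0 Gflip.
have -> : tr F (a + c)%MM (b + d)%MM = tr F a b * tr F c d - tr F (a + d)%MM (b + c)%MM.
  by rewrite trM addrK.
by apply: subalg_genB => //; apply: SubalgMul; apply: below => //; lia.
Qed.

Lemma gen_common k a b i :
    generated_below k -> (mdeg a + mdeg b <= k)%N -> balanced F a b ->
    (0 < a i)%N -> (0 < b i)%N ->
  subalg_gen NBD (tr F a b).
Proof.
move=> below dk ab /mnm_subU[a' Da] /mnm_subU[b' Db].
move: dk ab; rewrite {}Da {}Db balancedDl ?balancedUU // !mdegD mdeg1 => dk ab.
have -> : tr F (U_(i) + a')%MM (U_(i) + b')%MM = mon F U_(i)%MM U_(i)%MM * tr F a' b'.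
  by rewrite /tr mulrDr !monM.
by apply: SubalgMul; [apply/SubalgIn/NBD_N | apply: below => //; lia].
Qed.

(** Swapping x_i y_j into y_i x_j leaves another x_i next to the new y_i, so a factor
N_i appears. *)
Lemma gen_repeated k a b i j :
    generated_below k -> (mdeg a + mdeg b <= k)%N -> balanced F a b ->
    (1 < a i)%N -> (0 < b j)%N ->
  subalg_gen NBD (tr F a b).
Proof.
move=> below dk ab ai /mnm_subU[b' Db].
have [a' Da] := mnm_subU (ltnW ai).
move: dk ab ai; rewrite {}Da {}Db balancedDl ?balancedUU // !mdegD !mdeg1 => dk ab.
rewrite mnmDE mnm1E eqxx => ai.
have a'0 : (0 < mdeg a')%N by rewrite mdegE (bigD1 i) //=; lia.
rewrite addmC [X in tr _ _ X]addmC.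
apply: (gen_flip below) => //; rewrite ?balancedUU ?mdeg1 //; try lia.
apply: (@gen_common k _ _ i below); rewrite ?mdegD ?mdeg1 ?mnmDE ?mnm1E ?eqxx; try lia.
by rewrite addmC [X in balanced _ _ X]addmC balancedDl ?balancedUU.
Qed.

Lemma ind_support a : (forall i, (a i <= 1)%N) -> a = ind [set i : 'I_m | (0 < a i)%N].
Proof.
by move=> a1; apply/mnmP => i; rewrite indE inE; have := a1 i; case: (a i) => [|[]].
Qed.

(** The sum of the indices of the y's, which decreases whenever x_i y_j with i < j
is swapped into y_i x_j. *)
Definition ywt b := (\sum_(j < m) j * b j)%N.

Lemma ywtU i b : ywt (U_(i) + b)%MM = (i + ywt b)%N.
Proof.
rewrite /ywt; under eq_bigr => j _ do rewrite mnmDE mulnDr.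
rewrite big_split /=; congr (_ + _)%N.
rewrite (bigD1 i) //= big1 => [|j /negPf ji]; first by rewrite mnm1E eqxx muln1 addn0.
by rewrite mnm1E eq_sym ji muln0.
Qed.

(** After the monomials with a repeated or common variable are removed, only
squarefree monomials x_J y_I with I and J disjoint remain. Swapping pairs sorts
them until every index of a y precedes every index of an x, which is the shape
of an element of calD; a monomial without any y gives an element of calB. *)
Lemma gen_small k a b :
    generated_below k -> (mdeg a + mdeg b <= k)%N ->
    mdeg a = mdeg b \/ mdeg a = (mdeg b + q1)%N ->
  subalg_gen NBD (tr F a b).
Proof.
move=> below; have [w] := ubnP (ywt b).
elim: w a b => // w IHw a b; rewrite ltnS => wb dk dab.
have ab : balanced F a b by rewrite /balanced; case: dab => ->; rewrite ?modnDr.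
have [b0|b0] := posnP (mdeg b).
  move: b0 => /eqP; rewrite mdeg_eq0 => /eqP b0; move: dab; rewrite b0 mdeg0 add0n.
  case=> [/eqP|da]; last exact/SubalgIn/NBD_B.
  rewrite mdeg_eq0 => /eqP ->; rewrite /tr /mon join0 mpolyX0.
  by apply: SubalgAdd; apply: SubalgOne.
have a0 : (0 < mdeg a)%N by case: dab => ->; rewrite ?addn_gt0 b0.
have [ia aia] := mnm_pos a0; have [ib bib] := mnm_pos b0.
have [/existsP[i /andP[ai bi]]|nocommon] := boolP [exists i : 'I_m, (0 < a i) && (0 < b i)]%N.
  exact: (gen_common below dk ab ai bi).
have [/existsP[i ai]|/existsPn a1] := boolP [exists i : 'I_m, 1 < a i]%N.
  exact: (gen_repeated below dk ab ai bib).
have [/existsP[i bi]|/existsPn b1] := boolP [exists i : 'I_m, 1 < b i]%N.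
  rewrite trC; apply: (gen_repeated below _ _ bi aia); first by rewrite addnC.
  by rewrite balancedC.
set J := [set i : 'I_m | (0 < a i)%N]; set I := [set i | (0 < b i)%N].
have DJ : a = ind J by apply: ind_support => i; rewrite leqNgt.
have DI : b = ind I by apply: ind_support => i; rewrite leqNgt.
have J0 : J != set0 by apply/set0Pn; exists ia; rewrite inE.
have I0 : I != set0 by apply/set0Pn; exists ib; rewrite inE.
have [/'exists_existsP[i [j /and3P[ij ai bj]]]|sorted] :=
    boolP [exists i : 'I_m, exists j : 'I_m, [&& i < j, 0 < a i & 0 < b j]]%N; last first.
  rewrite trC DJ DI; apply/SubalgIn/NBD_D => //; last by rewrite -!mdeg_ind -DI -DJ.
  move=> i j; rewrite !inE => bi aj; rewrite ltnNge leq_eqVlt negb_or.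
  apply/andP; split.
    apply: contraNneq nocommon => /val_inj ji.
    by apply/existsP; exists i; rewrite -{1}ji aj.
  apply: contraNN sorted => ji; apply/existsP; exists j; apply/existsP; exists i.
  by rewrite ji aj.
have [a' Da] := mnm_subU ai; have [b' Db] := mnm_subU bj.
(* In degree 2 there is nothing left to swap with, but x_i y_j with i < j is
   already in calD, with the roles of x and y exchanged. *)
have [ab0|ab0] := posnP (mdeg a' + mdeg b').
  have /andP[/eqP a'0 /eqP b'0] : (a' == 0%MM) && (b' == 0%MM) by rewrite -!mdeg_eq0; lia.
  rewrite DI DJ; apply/SubalgIn/NBD_D => //.
    move=> u v; rewrite !inE Da Db a'0 b'0 !addm0 !mnm1E !lt0b.
    by move=> /eqP <- /eqP <-.
  by left; rewrite -!mdeg_ind -DI -DJ Da Db a'0 b'0 !addm0 !mdeg1.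
move: dk dab ab wb; rewrite Da Db !mdegD !mdeg1 balancedDl ?balancedUU // ywtU => dk dab ab wb.
rewrite addmC [X in tr _ _ X]addmC.
apply: (gen_flip below) => //; rewrite ?balancedUU ?mdeg1 //; try lia.
apply: IHw; rewrite ?mdegD ?mdeg1; try lia.
by rewrite addmC ywtU; lia.
Qed.

(** If |a| - |b| = t (q - 1) with t >= 2, swapping a factor of q - 1 of the x's lowers
t by 2, which leads to t = 0 or 1. *)
Lemma gen_tr a b : balanced F a b -> subalg_gen NBD (tr F a b).
Proof.
have [k] := ubnP (mdeg a + mdeg b); elim: k a b => // k below a b; rewrite ltnS => dk.
wlog ba : a b dk / (mdeg b <= mdeg a)%N.
  move=> IH ab; have [ba|/ltnW ab'] := leqP (mdeg b) (mdeg a); first exact: IH.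
  by rewrite trC; apply: IH; rewrite 1?addnC // balancedC.
have [e] := ubnP (mdeg a - mdeg b); elim: e a b dk ba => // e IHe a b dk ba.
rewrite ltnS => de ab.
have [t Dt] : exists t, mdeg a = (mdeg b + t * q1)%N.
  exists ((mdeg a - mdeg b) %/ q1)%N; rewrite divnK ?subnKC //.
  by rewrite -eqn_mod_dvd // ab.
have q0 := card_pred_gt0.
case: t Dt => [|[|t]] Dt.
- by apply: (gen_small below) => //; left; lia.
- by apply: (gen_small below) => //; right; lia.
have [|c [a' [Da dc]]] := @mnm_split a q1; first by rewrite Dt mulSn; lia.
move: dk ba de ab Dt; rewrite {}Da mdegD dc !mulSn => dk ba de ab Dt.
have bal0 : balanced F c 0%MM by rewrite /balanced dc mdeg0 modnn mod0n.
rewrite -[b]add0m balancedDl // in ab.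
rewrite addmC -[b]addm0.
apply: (gen_flip below) => //; rewrite ?mdeg0 ?dc; try lia.
rewrite addm0; apply: IHe; rewrite ?mdegD ?dc; try lia.
by rewrite -[a']add0m addmC addm0 -[a']add0m [(b + c)%MM]addmC balancedDl // balancedC.
Qed.

Lemma NBD_invariant p : NBD p -> O2_invariant F m p.
Proof.
case=> [[i ->]|[[a [da ->]]|[I [J [_ _ _ cIJ ->]]]]].
- by rewrite mon_xy; apply: invariant_monaa.
- by rewrite tr_B; apply: invariant_tr; rewrite /balanced da mdeg0 modnn mod0n.
- rewrite tr_D; apply: invariant_tr; rewrite /balanced !mdeg_ind.
  by case: cIJ => ->; rewrite ?modnDr.
Qed.

Lemma NBD_generates : generates NBD (O2_invariant F m).
Proof.
move=> p; split; first exact/invariant_subalg/NBD_invariant.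
by apply: invariant_in_subalg; [apply: gen_monaa | apply: gen_tr].
Qed.

Lemma NUBD_generates :
  generates (union (calN F m) (union (calU F m) (union (calB F m) (calD F m))))
    (O2_invariant F m).
Proof.
move=> p; split=> [|/NBD_generates].
  move/subalg_gen_sub => H; apply/NBD_generates/H => {H p} p [Np|[Up|BDp]].
  - by apply: SubalgIn; left.
  - case: Up => i [j [_ ->]].
    by rewrite !mon_xy; exact/gen_tr/balancedUU.
  - by apply: SubalgIn; right.
apply: subalg_gen_sub => r [Nr|BDr]; apply: SubalgIn; [by left|by right; right].
Qed.

End Generation.

(** * Minimality *)

Section Indecomposables.
Variables (F : finFieldType) (m : nat).
Implicit Types (a b c d z : 'X_{1..m}) (n : 'X_{1..m + m}) (p r : {mpoly F[m + m]}).

Local Notation q1 := (#|F| - 1)%N.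
Local Notation NBD := (union (calN F m) (union (calB F m) (calD F m))).

Lemma mcoeffM_eq0 k (f g : {mpoly F[k]}) (n : 'X_{1..k}) :
  (forall n1 n2 : 'X_{1..k}, n = (n1 + n2)%MM -> f@_n1 * g@_n2 = 0) -> (f * g)@_n = 0.
Proof. by move=> fg0; rewrite mcoeffM big1 // => l /eqP /fg0. Qed.

(** A functional certifying that p is indispensable: it kills the constants, the
decomposable invariants and all the generators but p. *)
Definition detects (L : {mpoly F[m + m]} -> F) p :=
  [/\ (forall r r', L (r + r') = L r + L r') /\ (forall (c : F) r, L (c *: r) = c * L r),
      L 1 = 0,
      forall r r', O2_invariant F m r -> O2_invariant F m r' ->
        r@_0%MM = 0 -> r'@_0%MM = 0 -> L (r * r') = 0,
      forall r, NBD r -> r <> p -> L r = 0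
    & L p != 0].

(** The invariants killed by L form a subalgebra: after the constant terms are split
off, a product rs contributes only multiples of L r, L s, L 1 and the value of L at
a decomposable element. *)
Lemma detected_not_generated L p (T : {mpoly F[m + m]} -> Prop) :
  detects L p -> (forall r, T r -> NBD r) -> ~ T p -> ~ subalg_gen T p.
Proof.
move=> [[LD LZ] L1 LM LS Lp] TS nTp.
suff LT r : subalg_gen T r -> O2_invariant F m r /\ L r = 0.
  by case/LT => _ Lp0; rewrite Lp0 eqxx in Lp.
elim=> {r} [r Tr||c r _ [ir Lr]|r s _ [ir Lr] _ [iS Ls]|r s _ [ir Lr] _ [iS Ls]].
- by split; [exact/NBD_invariant/TS | apply: LS (TS _ Tr) _ => rp; rewrite rp in Tr].
- by split; first exact: invariant1.
- by split; [exact: invariantZ | rewrite LZ Lr mulr0].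
- by split; [exact: invariantD | rewrite LD Lr Ls addr0].
split; first exact: invariantM.
have const0 t : O2_invariant F m t ->
    O2_invariant F m (t - t@_0%MM *: 1) /\ (t - t@_0%MM *: 1)@_0%MM = 0.
  move=> it; split; last by rewrite mcoeffB mcoeffZ mcoeff1 eqxx mulr1 subrr.
  by apply: invariantD => //; rewrite -scaleNr; apply/invariantZ/invariant1.
have [[ir' r0] [iS' s0]] := (const0 r ir, const0 s iS).
set r' := r - _ in ir' r0; set s' := s - _ in iS' s0.
(* Only the product of the parts without constant term is not a combination of
   r, s and 1. *)
have -> : r * s = r' * s' + r@_0%MM *: s + s@_0%MM *: r - (r@_0%MM * s@_0%MM) *: 1.
  rewrite /r' /s' mulrBl !mulrBr -!scalerAl -!scalerAr !mul1r !mulr1 scalerA.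
  by rewrite opprB; ring.
rewrite -scaleNr !LD !LZ LM // Lr Ls L1; ring.
Qed.

Lemma mnm_eq0_parts n : (n == 0%MM) = (mdeg (xpart n) + mdeg (ypart n) == 0)%N.
Proof.
rewrite addn_eq0 !mdeg_eq0 -[in LHS](join_parts n) -(join0 m) eq_join.
by [].
Qed.

Lemma mcoeff_linear k (n : 'X_{1..k}) :
  (forall r r' : {mpoly F[k]}, (r + r')@_n = r@_n + r'@_n) /\
  (forall (c : F) (r : {mpoly F[k]}), (c *: r)@_n = c * r@_n).
Proof. by split=> *; rewrite (mcoeffD, mcoeffZ). Qed.

(** An invariant without constant term only involves nonconstant balanced monomials,
so a product of two of them misses the balanced monomials that have no proper
balanced factor. *)
Lemma mcoeffM_atom n :
    (forall n1 n2, n = (n1 + n2)%MM -> balanced F (xpart n1) (ypart n1) ->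
       balanced F (xpart n2) (ypart n2) -> n1 = 0%MM \/ n2 = 0%MM) ->
  forall r r', O2_invariant F m r -> O2_invariant F m r' ->
    r@_0%MM = 0 -> r'@_0%MM = 0 -> (r * r')@_n = 0.
Proof.
move=> atom r r' ir ir' r0 r'0; apply: mcoeffM_eq0 => n1 n2 Dn.
have [-> | rn1] := eqVneq r@_n1 0; first exact: mul0r.
have [-> | rn2] := eqVneq r'@_n2 0; first exact: mulr0.
have [n10|n20] := atom _ _ Dn (invariant_balanced ir rn1) (invariant_balanced ir' rn2).
  by rewrite n10 r0 eqxx in rn1.
by rewrite n20 r'0 eqxx in rn2.
Qed.

(** Neither x_i nor y_i is balanced when q - 1 > 1, and x_i y_i occurs in no
generator other than N_i. *)
Lemma detects_N i : (1 < q1)%N ->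
  detects (mcoeff (join U_(i) U_(i))) (mon F U_(i) U_(i))%MM.
Proof.
move=> q_gt1; have U0 : (U_(i)%MM == 0%MM :> 'X_{1..m}) = false by rewrite mnm1_eq0.
split; first exact: mcoeff_linear.
- by rewrite mcoeff1 mnm_eq0_parts xpart_join ypart_join mdeg1.
- apply: mcoeffM_atom => n1 n2 Dn.
  have /(congr1 mdeg) := congr1 (@xpart m) Dn.
  have /(congr1 mdeg) := congr1 (@ypart m) Dn.
  rewrite xpartD ypartD xpart_join ypart_join !mdegD mdeg1 /balanced => y12 x12.
  rewrite !modn_small; try lia.
  by move=> e1 e2; case: (posnP (mdeg (xpart n1))) => x1; [left|right];
    apply/eqP; rewrite mnm_eq0_parts; lia.
- move=> r [[j ->]|[[a [_ ->]]|[I [J [/set0Pn[k kI] _ IJ _ ->]]]]].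
  + rewrite !mon_xy => ji; rewrite mcoeff_mon eq_mnm1; case: eqP => // E.
    by rewrite E in ji.
  + by rewrite tr_B mcoeffD !mcoeff_mon ![0%MM == _]eq_sym U0 andbF addr0.
  rewrite tr_D mcoeffD !mcoeff_mon [(ind J == _) && _]andbC.
  case: andP => [[/eqP <- /eqP /ind_inj E]|]; last by rewrite addr0.
  by have := IJ k k kI; rewrite E kI ltnn => /(_ isT).
- by rewrite mcoeff_mon !eqxx oner_eq0.
Qed.

(** A proper factor of a pure monomial of degree q - 1 in the x's is not
balanced. *)
Lemma detects_B a : mdeg a = q1 -> detects (mcoeff (join a 0%MM)) (tr F a 0%MM).
Proof.
move=> da; have q0 := card_pred_gt0 F.
have a0 : (a == 0%MM) = false by rewrite -mdeg_eq0 da; apply/negbTE; rewrite -lt0n.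
have ind_neq0 (I : {set 'I_m}) : I != set0 -> (ind I == 0%MM) = false.
  by rewrite -mdeg_eq0 mdeg_ind cards_eq0 => /negPf.
split; first exact: mcoeff_linear.
- by rewrite mcoeff1 mnm_eq0_parts xpart_join ypart_join mdeg0 addn0 mdeg_eq0 a0.
- apply: mcoeffM_atom => n1 n2 Dn.
  have /(congr1 mdeg) := congr1 (@xpart m) Dn.
  have /(congr1 mdeg) := congr1 (@ypart m) Dn.
  rewrite xpartD ypartD xpart_join ypart_join !mdegD da mdeg0 /balanced => y12 x12.
  have [-> ->] : mdeg (ypart n1) = 0%N /\ mdeg (ypart n2) = 0%N by lia.
  move=> e1 _; case: (posnP (mdeg (xpart n1))) => x1; [left|right];
    apply/eqP; rewrite mnm_eq0_parts; first lia.
  move: e1; rewrite mod0n => /(dvdn_leq x1); lia.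
- move=> r [[j ->]|[[b [_ ->]]|[I [J [I0 J0 _ _ ->]]]]].
  + by rewrite mon_xy mcoeff_mon mnm1_eq0 andbF.
  + rewrite tr_B => ba; rewrite mcoeffD !mcoeff_mon [0%MM == a]eq_sym a0 addr0 eqxx andbT.
    by case: eqP => // E; rewrite E in ba.
  by rewrite tr_D mcoeffD !mcoeff_mon !ind_neq0 // !andbF addr0.
- by rewrite mcoeffD !mcoeff_mon !eqxx [0%MM == a]eq_sym a0 addr0 oner_eq0.
Qed.

Section Collapse.
Variable k0 : 'I_m.

(** Identifying y_i with x_i turns an orbit sum into twice a monomial, that is 0 in
characteristic 2. Killing y_k0 keeps exactly one of the two monomials of the
orbit sum when k0 occurs, squarefree, in it. *)
Definition collapse p : {mpoly F[m]} :=
  p \mPo [tuple match split k with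
                | inl i => 'X_i
                | inr i => if i == k0 then 0 else 'X_i
                end | k < m + m].

Lemma collapse_xv i : collapse (xv F i) = 'X_i.
Proof.
rewrite /collapse /xv comp_mpolyXU -tnth_nth tnth_mktuple.
by rewrite -[lshift m i]/(unsplit (inl i)) unsplitK.
Qed.

Lemma collapse_yv i : collapse (yv F i) = if i == k0 then 0 else 'X_i.
Proof.
rewrite /collapse /yv comp_mpolyXU -tnth_nth tnth_mktuple.
by rewrite -[rshift m i]/(unsplit (inr i)) unsplitK.
Qed.

Lemma collapse_mon a b : collapse (mon F a b) = (b k0 == 0%N)%:R *: 'X_[a + b].
Proof.
have -> : collapse (mon F a b) = (\prod_(i < m) collapse (xv F i) ^+ a i) *
                        (\prod_(i < m) collapse (yv F i) ^+ b i).
  rewrite monE /collapse rmorphM !rmorph_prod /=.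
  by congr (_ * _); apply: eq_bigr => i _; rewrite rmorphXn.
under eq_bigr => i _ do rewrite collapse_xv.
under [X in _ * X]eq_bigr => i _ do rewrite collapse_yv.
rewrite -mpolyXE_id; have [bk|bk] := eqVneq (b k0) 0%N.
  rewrite scale1r mpolyXD [in RHS](mpolyXE_id _ b); congr (_ * _).
  apply: eq_bigr => i _; case: eqP => // ->; by rewrite bk !expr0.
by rewrite (bigD1 k0) //= eqxx expr0n (negPf bk) mul0r mulr0 scale0r.
Qed.

Lemma collapse_tr a b z :
  (collapse (tr F a b))@_z =
  ((a + b)%MM == z)%:R * ((b k0 == 0%N)%:R + (a k0 == 0%N)%:R).
Proof.
rewrite /collapse comp_mpolyD mcoeffD -![_ \mPo _]/(collapse _) !collapse_mon !mcoeffZ !mcoeffX.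
by rewrite [(b + a)%MM]addmC mulrDr; congr (_ + _); rewrite mulrC.
Qed.

Lemma collapse_const p : (collapse p)@_0%MM = p@_0%MM.
Proof.
rewrite {1}[p]mpolyE /collapse (raddf_sum (comp_mpoly _)) [in RHS](mpolyE p).
rewrite !(raddf_sum (mcoeff _)) /=; apply: eq_bigr => n _.
rewrite comp_mpolyZ !mcoeffZ -[_ \mPo _]/(collapse _) -{2}(join_parts n) collapse_mon.
congr (_ * _); rewrite mcoeffZ !mcoeffX mnmD_eq0 -[X in _ = (X == _)%:R](join_parts n).
rewrite -(join0 m) eq_join; have [->|_] := eqVneq (ypart n) 0%MM.
  by rewrite mnm0E mul1r.
by rewrite andbF mulr0.
Qed.

Definition squarefree z := forall i, (z i <= 1)%N.

Lemma collapse_N i z : squarefree z -> (collapse (mon F U_(i) U_(i))%MM)@_z = 0.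
Proof.
move=> z1; rewrite collapse_mon mcoeffZ mcoeffX.
case: ((_ + _)%MM =P z) => [E|]; last by rewrite mulr0.
by have := z1 i; rewrite -E mnmDE mnm1E eqxx.
Qed.

(** Away from k0, the orbit sums collapse to 0 and N_i collapses to a square. The
polynomials whose collapse has no such coefficient form a subalgebra, since a factorization of
a squarefree monomial avoiding k0 again consists of squarefree monomials
avoiding k0. *)
Lemma collapse_squarefree0 p z : 2%N \in [pchar F] ->
    subalg_gen NBD p -> squarefree z -> z k0 = 0%N -> z != 0%MM ->
  (collapse p)@_z = 0.
Proof.
move=> F2 Gp; elim: Gp z => {p} [p Np||c p _ IH|p r _ IHp _ IHr|p r _ IHp _ IHr] z z1 zk z0.
- have tr0 a b : (collapse (tr F a b))@_z = 0.
    rewrite collapse_tr; case: eqP => [E|]; last by rewrite mul0r.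
    move: zk; rewrite -E mnmDE => /eqP; rewrite addn_eq0 => /andP[-> ->].
    by rewrite mul1r addrr_pchar2.
  case: Np => [[i ->]|[[a [_ ->]]|[I [J [_ _ _ _ ->]]]]].
  + by rewrite mon_xy collapse_N.
  + by rewrite tr_B.
  + by rewrite tr_D.
- by rewrite /collapse comp_mpoly1 mcoeff1 (negPf z0).
- by rewrite /collapse comp_mpolyZ mcoeffZ [_@__]IH ?mulr0.
- by rewrite /collapse comp_mpolyD mcoeffD [X in X + _]IHp // [X in _ + X]IHr ?addr0.
rewrite /collapse rmorphM; apply: mcoeffM_eq0 => z2 z3 Dz.
move: z1 zk z0; rewrite Dz mnmDE mnmD_eq0 => z1 /eqP; rewrite addn_eq0 => /andP[/eqP k2 /eqP k3].
have [s2 s3] : squarefree z2 /\ squarefree z3.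
  by split=> i; have := z1 i; rewrite mnmDE; lia.
have [/= _ z30|z20 _] := eqVneq z2 0%MM; first by rewrite [X in _ * X]IHr ?mulr0.
by rewrite [X in X * _]IHp ?mul0r.
Qed.

End Collapse.

(** As q - 1 is odd, the parity of the size of the support tells the two cases apart,
hence the sizes of I and J are determined; and I consists of the first #|I|
elements of the support. *)
Lemma set_lt_unique (I J I' J' : {set 'I_m}) :
    set_lt I J -> set_lt I' J' -> odd q1 ->
    #|J| = #|I| \/ #|J| = (#|I| + q1)%N -> #|J'| = #|I'| \/ #|J'| = (#|I'| + q1)%N ->
    (ind I + ind J)%MM = (ind I' + ind J')%MM ->
  I = I' /\ J = J'.
Proof.
move=> IJ IJ' q_odd cJ cJ' E.
have cE : #|I| = #|I'|.
  have := congr1 mdeg E; rewrite !mdegD !mdeg_ind.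
  move: q_odd cJ cJ'; set q := q1; lia.
have mem i : ((i \in I) + (i \in J) = (i \in I') + (i \in J'))%N.
  by rewrite -!indE -!mnmDE E.
have II' : I = I'.
  apply/eqP; rewrite eqEcard cE leqnn andbT; apply/negPn/negP => /subsetPn[i iI iI'].
  have : ~~ (I' \subset I).
    by apply: contraNN iI' => sI; rewrite (_ : I' = I) //; apply/eqP; rewrite eqEcard sI cE leqnn.
  case/subsetPn => j jI' jI.
  have iJ' : i \in J' by have := mem i; rewrite iI (negPf iI'); lia.
  have jJ : j \in J by have := mem j; rewrite jI' (negPf jI); lia.
  by have := ltn_trans (IJ _ _ iI jJ) (IJ' _ _ jI' iJ'); rewrite ltnn.
by split=> //; apply: ind_inj; apply: (@addmI _ (ind I)); rewrite E II'.
Qed.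

(** In a factorization of the squarefree monomial on the union of I and J, one of the
two factors avoids k0, so its coefficient vanishes in the collapse of an
invariant without constant term. *)
Lemma detects_D (I J : {set 'I_m}) k0 :
    2%N \in [pchar F] -> odd q1 -> k0 \in I -> set_lt I J ->
    #|J| = #|I| \/ #|J| = (#|I| + q1)%N ->
  detects (fun p => (collapse k0 p)@_(ind I + ind J)) (tr F (ind I) (ind J)).
Proof.
move=> F2 q_odd kI IJ cIJ; set z := (ind I + ind J)%MM.
have kJ : k0 \notin J by apply/negP => kJ; have := IJ _ _ kI kJ; rewrite ltnn.
have dI : (0 < #|I|)%N by apply/card_gt0P; exists k0.
have z1 : squarefree z.
  move=> i; rewrite mnmDE !indE; case: (boolP (i \in I)) => iI; last by case: (i \in J).
  by case: (boolP (i \in J)) => // iJ; have := IJ _ _ iI iJ; rewrite ltnn.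
have z0 : z != 0%MM by rewrite -mdeg_eq0 mdegD mdeg_ind -lt0n addn_gt0 dI.
split.
- by split=> *; rewrite /collapse ?comp_mpolyD ?comp_mpolyZ (mcoeffD, mcoeffZ).
- by rewrite /collapse comp_mpoly1 mcoeff1 (negPf z0).
- move=> r r' /NBD_generates Gr /NBD_generates Gr' r0 r'0.
  rewrite /collapse rmorphM; apply: mcoeffM_eq0 => z2 z3 Dz.
  have [s2 s3] : squarefree z2 /\ squarefree z3.
    by split=> i; have := z1 i; rewrite Dz mnmDE; lia.
  have [->|z20] := eqVneq z2 0%MM; first by rewrite [X in X * _]collapse_const r0 mul0r.
  have [->|z30] := eqVneq z3 0%MM; first by rewrite [X in _ * X]collapse_const r'0 mulr0.
  have [k2|k2] := eqVneq (z2 k0) 0%N; first by rewrite [X in X * _]collapse_squarefree0 ?mul0r.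
  have k3 : z3 k0 = 0%N by have := z1 k0; rewrite Dz mnmDE; lia.
  by rewrite [X in _ * X]collapse_squarefree0 ?mulr0.
- move=> r [[j ->]|[[b [db ->]]|[I' [J' [_ _ IJ' cIJ' ->]]]]].
  + by rewrite mon_xy collapse_N.
  + rewrite tr_B collapse_tr addm0; case: eqP => [E|]; last by rewrite mul0r.
    have := congr1 mdeg E; rewrite db mdegD !mdeg_ind.
    by move: q_odd cIJ; set q := q1; lia.
  rewrite tr_D collapse_tr; case: eqP => [E|]; last by rewrite mul0r.
  by have [-> ->] := set_lt_unique IJ' IJ q_odd cIJ' cIJ E.
- by rewrite collapse_tr eqxx !indE kI (negPf kJ) addr0 mulr1 oner_eq0.
Qed.

Lemma NBD_minimal : 2%N \in [pchar F] -> odd q1 -> (1 < q1)%N ->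
  minimal_generating_set NBD (O2_invariant F m).
Proof.
move=> F2 q_odd q_gt1; split; first exact: NBD_generates.
move=> T [TS [p Np nTp]] genT.
suff [L dL] : exists L, detects L p.
  apply: (detected_not_generated dL TS nTp); apply/genT; exact: NBD_invariant.
case: Np => [[i ->]|[[a [da ->]]|[I [J [I0 _ IJ cIJ ->]]]]].
- by rewrite mon_xy; exists (mcoeff (join U_(i) U_(i))%MM); apply: detects_N.
- by rewrite tr_B; exists (mcoeff (join a 0%MM)); apply: detects_B.
have [k kI] := set0Pn _ I0.
by rewrite tr_D; exists (fun p => (collapse k p)@_(ind I + ind J)%MM); apply: detects_D.
Qed.

End Indecomposables.

Theorem theorem1p1 (s : nat) (hs : (2 <= s)%N) (F : finFieldType)
    (hF : #|F| = (2 ^ s)%N) (m : nat) (hm : (1 <= m)%N) :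
  generates (union (calN F m) (union (calU F m) (union (calB F m) (calD F m))))
    (O2_invariant F m)
  /\
  minimal_generating_set (union (calN F m) (union (calB F m) (calD F m)))
    (O2_invariant F m).
Proof.
split; first exact: NUBD_generates.
have q4 : (4 <= 2 ^ s)%N by rewrite -[4%N]/(2 ^ 2)%N leq_exp2l.
apply: NBD_minimal.
- exact: card_finPcharP hF _.
- rewrite hF oddB ?expn_gt0 // oddX /=; move: hs; lia.
- by rewrite hF; lia.
Qed.
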